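(* Let $q$ be a prime power. Let $n,k,t$ be positive integers and $s$ a non-negative integer such that $k\ge s+t+1$ and $n\ge 2k+s+1$. Let $\mathcal F\subset \mathcal V_n^k$ be $t$-intersecting. Then there exists a $t$-intersecting family $\mathcal C_{s+t}$ of subspaces of $V(n,q)$ of dimension at most $s+t$ such that $$|\mathcal F\setminus \mathcal F[\mathcal C_{s+t}]|\le C\, q^{(k-t)(n-k)-(s+1)(n-k-t-s-1)},$$ where $C = 2\left(\frac q{q-1}\right)^{k-t+1}\left(1 + \frac{q+1}{q^2-q-1}\right)^2$ if $n = 2k+s+1$, and $C=\left(\frac q{q-1}\right)^{s+3}\left(1 + \frac{q+1}{q^2-q-1}\right)^2$ if $n\ge 2k+s+2$.
   Context: $V(n,q)$ denotes the $n$-dimensional vector space over the field with $q$ elements, and $\mathcal V_n^k$ denotes the family of all $k$-dimensional subspaces of $V(n,q)$. A family of subspaces is $t$-intersecting if any two of its members (not necessarily distinct) intersect in a subspace of dimension at least $t$; in particular every member has dimension at least $t$. For a family $\mathcal F$ of subspaces and a subspace $X$, $\mathcal F[X]:=\{S\in\mathcal F: X\subset S\}$; for a family $\mathcal X$ of subspaces, $\mathcal F[\mathcal X]:=\bigcup_{X\in\mathcal X}\mathcal F[X]$. *)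

(* Defs.v *)
From HB Require Import structures.
From mathcomp Require Import all_boot all_order all_algebra.
Set Implicit Arguments.
Unset Strict Implicit.
Unset Printing Implicit Defensive.

Import Order.TTheory GRing.Theory Num.Theory.

(* MathComp only provides a choiceType structure on {vspace vT}; over a finite
   field there are finitely many subspaces, so that families of subspaces can
   be taken in {set {vspace vT}}. *)
Import VectorInternalTheory.
HB.instance Definition _ (F : finFieldType) (vT : vectType F) :=
  [Countable of {vspace vT} by <:].
HB.instance Definition _ (F : finFieldType) (vT : vectType F) :=
  [Finite of {vspace vT} by <:].

Section SubspaceFamilies.

Variables (F : finFieldType) (n : nat).
Implicit Types (A B : {set {vspace 'rV[F]_n}}) (X S : {vspace 'rV[F]_n}).

Definition k_subspaces (k : nat) : {set {vspace 'rV[F]_n}} :=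
  [set S : {vspace 'rV[F]_n} | \dim S == k].

Definition t_intersecting (t : nat) A : Prop :=
  forall S1 S2, S1 \in A -> S2 \in A -> (t <= \dim (S1 :&: S2)%VS)%N.

Definition members_above A X : {set {vspace 'rV[F]_n}} :=
  [set S in A | (X <= S)%VS].

Definition members_above_family A B : {set {vspace 'rV[F]_n}} :=
  \bigcup_(X in B) members_above A X.

End SubspaceFamilies.

Local Open Scope ring_scope.

Definition bound_constant (q n k t s : nat) : rat :=
  let x : rat := q%:R in
  if n == (2 * k + s + 1)%N then
    2 * (x / (x - 1)) ^+ (k - t + 1) * (1 + (x + 1) / (x ^+ 2 - x - 1)) ^+ 2
  else (x / (x - 1)) ^+ (s + 3) * (1 + (x + 1) / (x ^+ 2 - x - 1)) ^+ 2.

(* Written over int so that no subtraction is truncated. *)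
Definition bound_exponent (n k t s : nat) : int :=
  (k%:Z - t%:Z) * (n%:Z - k%:Z) -
  (s%:Z + 1) * (n%:Z - k%:Z - t%:Z - s%:Z - 1).

(* Main.v *)
Require Import Defs.
From mathcomp Require Import all_boot all_order all_algebra all_field.
From mathcomp Require Import zify ring lra.
Import Order.TTheory GRing.Theory Num.Theory.

Set Implicit Arguments.
Unset Strict Implicit.
Unset Printing Implicit Defensive.

Local Open Scope ring_scope.

(** The family is peeled one dimension at a time. Let T be a t-intersecting
    family of subspaces of dimension at most j; at the start T is the given
    family and j = k. Replace T by a t-intersecting family M, still of
    dimensions at most j, such that every member of T contains a member of M,
    and choose M with the sum of its dimensions as small as possible
    ([minimal_refinement]). Nothing above T is lost. Minimality means that no
    member W of M can be shrunk: if Y is a proper subspace of W with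
    dim Y >= t, some X in M has dim (Y :&: X) < t. Dropping from M its members
    of dimension exactly j leaves a t-intersecting family of dimensions below
    j, and loses at most the members of the given family that lie above one of
    the dropped subspaces. After k - s - t rounds the dimensions are at most
    s + t.

    There are few j-dimensional members in M ([card_level]). Fix one of them,
    X0. Any other meets X0 in dimension at least t, so it contains one of the
    about q^(t(j-t)) t-dimensional subspaces of X0. From such a Y the member W
    is reached one vector at a time: as long as Y is smaller than W, minimality
    gives X in M with dim (Y :&: X) < t, hence a subspace U of X, disjoint from
    Y, of dimension dim X - t + 1. As W meets X in dimension at least t, it
    contains a nonzero vector of U. So W contains one of at most
    (q^(j-t+1) - 1)/(q - 1) subspaces Y + <v>, and this number is at most
    x q^(j-t) with x = q/(q - 1) ([card_level_above]). Altogether there are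
    about x^(j-t) q^(j(j-t)) members of dimension j, each contained in about
    q^((k-j)(n-k)) subspaces of dimension k.

    Both Gaussian binomial coefficients cost a factor
    1/(1 - 1/q - 1/q^2) = 1 + (q + 1)/(q^2 - q - 1), because partial products
    of Euler's product of the factors 1 - q^(-i) stay above 1 - 1/q - 1/q^2
    ([euler_product_ge]).

    It remains to sum over the dimensions j = s + t + 1 + a with 0 <= a <= m,
    where m = k - s - t - 1. Writing n = 2k + s + 1 + d, the exponent of q at j
    falls short of its value at a = 0 by exactly a(m - a) + a d
    ([loss_exponentE]). When d = 0 both ends a = 0 and a = m contribute equally,
    which is where the factor 2 comes from ([tight_sum_le]); when d > 0 the sum
    is dominated by a = 0 and costs only x^2 ([slack_sum_le]). *)

(** * Estimates for sums and products of powers of 1/q *)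

Section Estimates.

Variables (R : realFieldType) (y : R).
Hypotheses (y_gt0 : 0 < y) (y_le_half : 2 * y <= 1).

Let y_ge0 : 0 <= y. Proof. exact: ltW. Qed.
Let y_lt1 : y < 1. Proof. by move: y_gt0 y_le_half; lra. Qed.
Let y_le1 : y <= 1. Proof. exact: ltW. Qed.
Let x := (1 - y)^-1.
Let x_gt0 : 0 < x. Proof. by rewrite invr_gt0 subr_gt0. Qed.
Let x_ge0 : 0 <= x. Proof. exact: ltW. Qed.
Let x_mul : x * (1 - y) = 1. Proof. by rewrite mulVf // subr_eq0 gt_eqF. Qed.
Let x_ge1 : 1 <= x. Proof. by move: x_mul x_ge0 y_ge0; nra. Qed.
Let xy_le1 : x * y <= 1. Proof. by move: x_mul x_ge0 y_le_half; nra. Qed.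

(** The bound is the start of Euler's pentagonal series. The induction needs the
    spare term y^(m+1) that the product still carries above it. *)
Lemma euler_product_ge m : 1 - y - y ^+ 2 <= \prod_(i < m) (1 - y ^+ i.+1).
Proof.
suff H: 1 - y - y ^+ 2 + y ^+ m.+2 <= \prod_(i < m.+1) (1 - y ^+ i.+1).
  have := H; rewrite big_ord_recr /= => {}H.
  have P0 : 0 <= \prod_(i < m) (1 - y ^+ i.+1).
    by apply: prodr_ge0 => i _; rewrite subr_ge0 exprn_ile1.
  have := exprn_ge0 m.+1 y_ge0; have := exprn_ge0 m.+2 y_ge0; nra.
elim: m => [|m IH]; first by rewrite big_ord_recl big_ord0 /=; lra.
rewrite big_ord_recr /=.
have z_ge0 := exprn_ge0 m y_ge0.
have z_le1 : y ^+ m <= 1 by rewrite exprn_ile1.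
have fac_ge0 : 0 <= 1 - y ^+ m.+2 by rewrite subr_ge0 exprn_ile1.
apply: le_trans (ler_wpM2r fac_ge0 IH); rewrite !exprS.
move: (y ^+ m) z_ge0 z_le1 => z z_ge0 z_le1.
have := mulr_ge0 (mulr_ge0 (exprn_ge0 4 y_ge0) z_ge0) (_ : 0 <= 1 - z).
by rewrite subr_ge0 => /(_ z_le1); lra.
Qed.

Lemma euler_const_gt0 : 0 < 1 - y - y ^+ 2.
Proof. by move: y_gt0 y_le_half; nra. Qed.

Lemma geometric_sum_le m : \sum_(i < m) y ^+ i <= x.
Proof.
have Pm := exprn_ge0 m y_ge0; have := subrX1 y m => E.
rewrite -[leLHS]mul1r -x_mul -mulrA -[leRHS]mulr1 ler_wpM2l //; lra.
Qed.

(** The exponent a(m - a) is at least min(a, m - a), so the sum is bounded by two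
    geometric series, one started at each end. *)
Lemma balanced_sum_le m : \sum_(a < m.+1) y ^+ (a * (m - a)) <= 2 * x.
Proof.
have le_split (a : 'I_m.+1) : y ^+ (a * (m - a)) <= y ^+ a + y ^+ (m - a).
  have [le_am|lt_ma] := leqP (m - a)%N (a * (m - a))%N.
    by apply: ler_wpDl; [exact: exprn_ge0 | exact: ler_wiXn2l].
  by apply: ler_wpDr; [exact: exprn_ge0 | apply: ler_wiXn2l => //; nia].
apply: (le_trans (ler_sum _ (fun a _ => le_split a))); rewrite big_split /=.
have -> : \sum_(a < m.+1) y ^+ (m - a) = \sum_(a < m.+1) y ^+ a.
  rewrite (reindex_inj rev_ord_inj); apply: eq_bigr => i _ /=.
  by congr (_ ^+ _); have := ltn_ord i; lia.
by have := geometric_sum_le m.+1; lra.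
Qed.

Lemma tight_sum_le m :
  \sum_(a < m.+1) x ^+ a * y ^+ (a * (m - a)) <= 2 * x ^+ m.+1.
Proof.
apply: (@le_trans _ _ (\sum_(a < m.+1) x ^+ m * y ^+ (a * (m - a)))).
  apply: ler_sum => a _; rewrite ler_wpM2r ?exprn_ge0 //.
  by rewrite ler_weXn2l // -ltnS ltn_ord.
rewrite -mulr_sumr exprSr mulrCA; apply: ler_wpM2l; first exact: exprn_ge0.
exact: balanced_sum_le.
Qed.

(** As x y <= 1, the terms with a >= 1 are at most x y y^(m - a), so that they add
    up to at most x y x; and 1 + x y x <= x^2 is x >= 1 in disguise, because
    x^2 (1 - y) = x. *)
Lemma slack_sum_le m d : (0 < d)%N ->
  \sum_(a < m.+1) x ^+ a * y ^+ (a * (m - a) + a * d) <= x ^+ 2.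
Proof.
move=> d_gt0; rewrite big_ord_recl /= !mul0n addn0 !expr0 mulr1.
have step (i : 'I_m) :
    x ^+ (lift ord0 i) * y ^+ (lift ord0 i * (m - lift ord0 i) + lift ord0 i * d)
      <= x * y * y ^+ (m - i.+1).
  rewrite /= /bump /= add1n.
  apply: (@le_trans _ _ (x ^+ i.+1 * y ^+ (i.+1 + (m - i.+1)))).
    by rewrite ler_wpM2l ?exprn_ge0 // ler_wiXn2l //; nia.
  rewrite exprD mulrA -exprMn ler_wpM2r ?exprn_ge0 //.
  by rewrite exprS ler_piMr ?exprn_ile1 ?mulr_ge0.
apply: (@le_trans _ _ (1 + x * y * x)); last first.
  have -> : x ^+ 2 = x * (x * (1 - y)) + x * y * x by ring.
  by rewrite x_mul mulr1 lerD2r.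
rewrite lerD2l; apply: (le_trans (ler_sum _ (fun i _ => step i))).
rewrite -mulr_sumr ler_wpM2l ?mulr_ge0 //.
rewrite (reindex_inj rev_ord_inj) /=.
apply: le_trans (geometric_sum_le m); apply: ler_sum => i _.
by rewrite ler_wiXn2l //; have := ltn_ord i; lia.
Qed.

End Estimates.

Section InverseOfFieldSize.

Variables (q : nat) (q_gt1 : (1 < q)%N).

Lemma natr_gt0 : 0 < q%:R :> rat. Proof. by rewrite ltr0n ltnW. Qed.

Lemma natr_inv_gt0 : 0 < q%:R^-1 :> rat.
Proof. by rewrite invr_gt0 natr_gt0. Qed.

Lemma natr_inv_le_half : 2 * q%:R^-1 <= 1 :> rat.
Proof. by rewrite ler_pdivrMr ?natr_gt0 // mul1r ler_nat. Qed.

Lemma natr_inv_lt1 : q%:R^-1 < 1 :> rat.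
Proof. by have := natr_inv_gt0; have := natr_inv_le_half; lra. Qed.

End InverseOfFieldSize.

(** * Counting subspaces by adding one vector at a time *)

Lemma card_bigcup_le (I T : finType) (B : {pred I}) (f : I -> {set T}) :
  (#|\bigcup_(i in B) f i| <= \sum_(i in B) #|f i|)%N.
Proof.
elim/big_rec2: _ => [|i n A _ IH]; first by rewrite cards0.
by apply: leq_trans (leq_card_setU _ _).1 _; rewrite leq_add2l.
Qed.

Section Counting.

Variables (F : finFieldType) (n : nat).
Local Notation V := 'rV[F]_n.
Local Notation q := #|F|.
Implicit Types (A : {set {vspace V}}) (X Y W S U : {vspace V}).

Lemma subspace_of_dim X d : (d <= \dim X)%N ->
  exists2 U, (U <= X)%VS & \dim U = d.
Proof.
move=> le_dX; have free_b := basis_free (vbasisP X).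
exists <<take d (vbasis X)>>%VS.
  apply: subv_trans (_ : (<<vbasis X>> <= X)%VS).
    by apply: sub_span => v; apply: mem_take.
  by rewrite (span_basis (vbasisP X)).
rewrite -(cat_take_drop d (vbasis X)) in free_b.
have := catl_free free_b; rewrite /free => /eqP ->.
by rewrite size_takel // size_tuple.
Qed.

(** Double counting of the pairs (v, W) with v in P and Y + <v> below W: this is
    the step from Y to Y + <v> in both of the counts below. *)
Lemma double_count_lines A Y (P : {set V}) (a : nat) (b : rat) :
  (forall W, W \in members_above A Y -> (a <= #|[set v in P | v \in W]|)%N) ->
  (forall v, v \in P -> #|members_above A (Y + <[v]>)|%:R <= b) ->
  a%:R * #|members_above A Y|%:R <= #|P|%:R * b.
Proof.
move=> many few.
apply: (@le_trans _ _ (\sum_(v in P) #|members_above A (Y + <[v]>)|%:R)); last first.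
  by rewrite mulr_natl -sumr_const; apply: ler_sum.
rewrite -natr_sum -natrM ler_nat mulnC -sum_nat_const.
apply: (@leq_trans (\sum_(W in members_above A Y) #|[set v in P | v \in W]|)%N).
  exact: leq_sum.
rewrite (eq_bigr (fun W => \sum_(v in P) (v \in W))%N); last first.
  move=> W _; rewrite -sum1_card big_mkcond [RHS]big_mkcond /=.
  by apply: eq_bigr => v _; rewrite inE; case: (v \in P); case: (v \in W).
rewrite exchange_big /=; apply: leq_sum => v _.
rewrite -[leqRHS]sum1_card big_mkcond [leqRHS]big_mkcond /=.
apply: leq_sum => W _; rewrite !inE subv_add -memvE.
by case: (W \in A); case: (Y <= W)%VS; case: (v \in W).
Qed.

Let q_gt1 : (1 < q)%N := finNzRing_gt1 F.
Let y : rat := q%:R^-1.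
Let q_neq0 : q%:R != 0 :> rat. Proof. by rewrite gt_eqF ?natr_gt0. Qed.
Let y_gt0 : 0 < y := natr_inv_gt0 q_gt1.
Let y_le_half : 2 * y <= 1 := natr_inv_le_half q_gt1.
Let y_lt1 : y < 1 := natr_inv_lt1 q_gt1.

Lemma dim_add_line Y v : v \notin Y -> \dim (Y + <[v]>) = (\dim Y).+1.
Proof.
move=> vY; rewrite dimv_disjoint_sum.
  rewrite dim_vline; case: eqP vY => [->|_ _]; first by rewrite mem0v.
  by rewrite addn1.
apply/eqP; rewrite -subv0; apply/subvP => u; rewrite memv_cap memv0 => /andP[uY].
case/vlineP => c Du; move: uY; rewrite Du; have [->|c0] := eqVneq c 0.
  by rewrite scale0r eqxx.
by rewrite rpredZeq (negPf c0) => /(negP vY).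
Qed.

Definition subspaces_within X k : {set {vspace V}} :=
  [set S in k_subspaces F n k | (S <= X)%VS].

(** A k-dimensional S above Y has q^k - q^(dim Y) vectors outside Y, and X has at
    most q^(dim X) of them; each vector added thus costs a factor
    q^(dim X - k) / (1 - q^(dim Y - k)). *)
Lemma card_subspaces_between_prod X Y k :
  #|members_above (subspaces_within X k) Y|%:R
    <= \prod_(i < k - \dim Y) (q%:R ^+ (\dim X - k) / (1 - y ^+ i.+1)).
Proof.
have fac_gt0 i : 0 < 1 - y ^+ i.+1.
  by rewrite subr_gt0 exprn_ilt1 ?ltW.
have prod_ge0 r : 0 <= \prod_(i < r) (q%:R ^+ (\dim X - k) / (1 - y ^+ i.+1)).
  by apply: prodr_ge0 => i _; rewrite divr_ge0 ?exprn_ge0 ?ler0n // ltW.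
have [->|[S0]] := set_0Vmem (members_above (subspaces_within X k) Y);
  first by rewrite cards0.
rewrite !inE => /andP[/andP[/eqP dimS0 S0X] YS0].
have le_kX : (k <= \dim X)%N by rewrite -dimS0 dimvS.
have : (\dim Y <= k)%N by rewrite -dimS0 dimvS.
move=> {S0 dimS0 S0X YS0}; move Dr: (k - \dim Y)%N => r le_Yk.
have {Dr le_Yk} : (k = \dim Y + r)%N by lia.
elim: r Y => [|r IHr] Y Dk.
  rewrite big_ord0 (ler_nat _ _ 1); apply: (@leq_trans #|[set Y]|); last by rewrite cards1.
  apply: subset_leq_card.
  apply/subsetP => S; rewrite !inE => /andP[/andP[/eqP dimS _] YS].
  by rewrite eq_sym eqEdim YS dimS Dk addn0 /=.
pose P : {set V} := [set v in X | v \notin Y].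
have := @double_count_lines (subspaces_within X k) Y P (q ^ k - q ^ \dim Y) _ _ _.
move=> /(_ (\prod_(i < r) (q%:R ^+ (\dim X - k) / (1 - y ^+ i.+1)))) H.
rewrite big_ord_recr /=; set B := \prod_(i < r) _ in H *.
have q_k : q%:R ^+ k * y ^+ r.+1 = q%:R ^+ \dim Y :> rat.
  by rewrite Dk exprD exprVn mulfK ?expf_neq0.
have q_X : q%:R ^+ \dim X = q%:R ^+ k * q%:R ^+ (\dim X - k) :> rat.
  by rewrite -exprD subnKC.
have qk_gt0 : 0 < q%:R ^+ k :> rat by rewrite exprn_gt0 // ltr0n ltnW.
rewrite mulrA ler_pdivlMr //.
rewrite -(ler_pM2l qk_gt0).
have -> : q%:R ^+ k * (#|members_above (subspaces_within X k) Y|%:R * (1 - y ^+ r.+1))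
    = (q ^ k - q ^ \dim Y)%N%:R * #|members_above (subspaces_within X k) Y|%:R.
  rewrite natrB; last by rewrite leq_exp2l // Dk leq_addr.
  by rewrite !natrX -q_k; ring.
apply: (le_trans (H _ _)); last first.
- rewrite mulrCA -q_X [leRHS]mulrC ler_wpM2r ?prod_ge0 //.
  rewrite -natrX ler_nat -card_vspace; apply: subset_leq_card.
  by apply/subsetP => v; rewrite !inE => /andP[].
- move=> v; rewrite inE => /andP[vX vY]; apply: IHr.
  by rewrite dim_add_line //; lia.
- move=> W; rewrite !inE => /andP[/andP[/eqP dimW WX] YW].
  rewrite leq_subLR addnC -dimW -!card_vspace.
  rewrite -(cardID (mem Y) (mem W)) addnC; apply: leq_add; last first.
    by apply: subset_leq_card; apply/subsetP=> v; rewrite !inE => /andP[].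
  apply: subset_leq_card; apply/subsetP=> v; rewrite !inE => /andP[vY vW].
  by rewrite (subvP WX) // vY.
Qed.

Lemma card_subspaces_between X Y k :
  #|members_above (subspaces_within X k) Y|%:R
    <= (1 - y - y ^+ 2)^-1 * q%:R ^+ ((k - \dim Y) * (\dim X - k)).
Proof.
apply: le_trans (card_subspaces_between_prod X Y k) _.
rewrite big_split /= prodr_const card_ord -exprM mulrC [(_ * (k - _))%N]mulnC.
rewrite ler_wpM2r ?exprn_ge0 // prodfV.
have c0 := euler_const_gt0 y_gt0 y_le_half.
rewrite lef_pV2 ?posrE //; last apply: lt_le_trans c0 _;
  exact: euler_product_ge.
Qed.

End Counting.

(** * Shrinking an intersecting family *)

Section Peeling.

Variables (F : finFieldType) (n : nat).
Local Notation V := 'rV[F]_n.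
Local Notation q := #|F|.
Local Notation y := (q%:R^-1 : rat).
Local Notation x := ((1 - y)^-1).
Local Notation G := ((1 - y - y ^+ 2)^-1).
Implicit Types (M T C : {set {vspace V}}) (X Y Z W S U : {vspace V}).

(** This is irreducibility of a t-intersecting family: X differs from W, because
    Y :&: W = Y has dimension at least t, so X is still there when Y takes the
    place of W. *)
Definition shrinking_breaks t M : Prop :=
  forall W Y, W \in M -> (Y <= W)%VS -> Y != W ->
  (t <= \dim Y)%N -> exists2 X, X \in M & (\dim (Y :&: X) < t)%N.

(** Minimality is measured by the sum of the dimensions, which drops whenever a
    member is replaced by a proper subspace, even if that subspace was already a
    member. *)
Lemma minimal_refinement t j T : t_intersecting t T ->
    (forall X, X \in T -> (\dim X <= j)%N) ->
  exists M, [/\ t_intersecting t M, forall X, X \in M -> (\dim X <= j)%N,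
    forall X, X \in T -> exists2 Z, Z \in M & (Z <= X)%VS & shrinking_breaks t M].
Proof.
move=> intT dimT.
pose good M := [&& [forall X in M, forall Z in M, t <= \dim (X :&: Z)],
  [forall X in M, \dim X <= j] & [forall X in T, exists Z in M, (Z <= X)%VS]]%N.
have goodP M : reflect [/\ t_intersecting t M,
    forall X, X \in M -> (\dim X <= j)%N
    & forall X, X \in T -> exists2 Z, Z \in M & (Z <= X)%VS] (good M).
  apply: (iffP and3P) => -[].
    move=> /forall_inP intM /forall_inP dimM /forall_inP covM.
    split=> // [X Z XM ZM|X XT]; first by move/forall_inP: (intM X XM); apply.
    by move/covM/exists_inP: XT.
  move=> intM dimM covM; split.
  - by apply/forall_inP => X XM; apply/forall_inP => Z; apply: intM.
  - exact/forall_inP.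
  - by apply/forall_inP => X /covM XT; apply/exists_inP.
have goodT : good T by apply/goodP; split=> // X XT; exists X.
case: (arg_minnP (fun M => \sum_(X in M) \dim X)%N goodT) => M /goodP[intM dimM covM] minM.
exists M; split=> // W Y WM YW WY le_tY.
case: (pickP [pred X in M | \dim (Y :&: X) < t]%N) => [X /andP[XM ltX]|no]; first by exists X.
have intY X : X \in M -> (t <= \dim (Y :&: X))%N.
  by move=> XM; have := no X; rewrite /= XM ltnNge /= => /negbFE.
have lt_dim : (\dim Y < \dim W)%N.
  by rewrite ltnNge; apply: contra WY => le; have := eqEdim Y W; rewrite YW le => /eqP->.
suff /minM : good (Y |: M :\ W).
  rewrite (big_setD1 W WM) /=.
  have [YM|YM] := boolP (Y \in M :\ W); last by
    rewrite big_setU1 //= leq_add2r leqNgt lt_dim.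
  have -> : Y |: M :\ W = M :\ W by apply/setUidPr; rewrite sub1set.
  by rewrite -[leqRHS]add0n leq_add2r leqNgt (leq_ltn_trans _ lt_dim).
apply/goodP; split.
- move=> X Z; rewrite !inE => /predU1P[->|/andP[_ XM]] /predU1P[->|/andP[_ ZM]].
  + by rewrite capvv.
  + exact: intY.
  + by rewrite capvC intY.
  + exact: intM.
- move=> X; rewrite !inE => /predU1P[->|/andP[_ XM]]; last exact: dimM.
  by apply: leq_trans (ltnW lt_dim) (dimM W WM).
- move=> X /covM[Z ZM ZX]; have [DZ|ZW] := eqVneq Z W.
    by exists Y; rewrite ?setU11 // (subv_trans YW) // -DZ.
  by exists Z; rewrite // !inE ZW ZM orbT.
Qed.

Let q_gt1 : (1 < q)%N := finNzRing_gt1 F.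
Let q_gt0 : 0 < q%:R :> rat := natr_gt0 q_gt1.
Let y_gt0 : 0 < y := natr_inv_gt0 q_gt1.
Let y_le_half : 2 * y <= 1 := natr_inv_le_half q_gt1.
Let y_lt1 : y < 1 := natr_inv_lt1 q_gt1.
Let x_ge0 : 0 <= x. Proof. by rewrite invr_ge0 subr_ge0 ltW. Qed.
Let G_ge0 : 0 <= G.
Proof. by rewrite invr_ge0 ltW // euler_const_gt0. Qed.

Definition level M j : {set {vspace V}} := [set W in M | \dim W == j].

(** Every W in the level above Y meets the same subspace U, disjoint from Y, in
    at least q - 1 nonzero vectors. Taking U of dimension dim X - t + 1 only,
    instead of all of X, keeps the cost of one more dimension at q^(j-t). *)
Lemma card_level_above t j M Y :
    t_intersecting t M -> (forall X, X \in M -> (\dim X <= j)%N) ->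
    shrinking_breaks t M -> (t <= \dim Y)%N ->
  #|members_above (level M j) Y|%:R <= (x * q%:R ^+ (j - t)) ^+ (j - \dim Y).
Proof.
move=> intM dimM proofM.
have base_ge0 : 0 <= x * q%:R ^+ (j - t) by rewrite mulr_ge0 // exprn_ge0 // ltW.
move Dr: (j - \dim Y)%N => r; elim: r Y Dr => [|r IHr] Y Dr le_tY.
  rewrite expr0 (ler_nat _ _ 1); apply: (@leq_trans #|[set Y]|); last by rewrite cards1.
  apply: subset_leq_card; apply/subsetP => W.
  rewrite !inE => /andP[/andP[_ /eqP dimW] YW].
  by rewrite eq_sym eqEdim YW dimW /=; lia.
have [->|[W0]] := set_0Vmem (members_above (level M j) Y);
  first by rewrite cards0 exprn_ge0.
rewrite !inE => /andP[/andP[W0M /eqP dimW0] YW0].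
have YneW0 : Y != W0 by apply/eqP => DY; move: Dr; rewrite DY dimW0 subnn.
have [X XM lt_YX] := proofM W0 Y W0M YW0 YneW0 le_tY.
have le_tX : (t <= \dim X)%N by rewrite -(capvv X) intM.
(* The dimension of U is the least one that forces U to meet every subspace of X
   of dimension t; since dim (X :&: Y) < t, a complement has room for it. *)
have [U UX dimU] : exists2 U, (U <= X :\: Y)%VS & \dim U = (\dim X - t).+1.
  apply: subspace_of_dim; rewrite -(ltn_add2l (\dim (Y :&: X))) capvC dimv_cap_compl.
  by rewrite -[ltnRHS](subnK le_tX) addnC ltn_add2l capvC.
have UY0 v : v \in U -> v \in Y -> v = 0.
  move=> vU vY; apply/eqP; rewrite -memv0 -(capv_diff X Y) memv_cap vY andbT.
  exact: subvP vU.
pose P : {set V} := [set v in U | v != 0].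
have H := @double_count_lines F n (level M j) Y P (q - 1)
  ((x * q%:R ^+ (j - t)) ^+ r) _ _.
have q1_gt0 : 0 < (q - 1)%N%:R :> rat by rewrite ltr0n subn_gt0.
rewrite -(ler_pM2l q1_gt0); apply: (le_trans (H _ _)).
- move=> W; rewrite !inE => /andP[/andP[WM _] _].
  have UW_gt0 : (0 < \dim (U :&: W))%N.
    have sum_le : (\dim (U + W :&: X) <= \dim X)%N.
      by rewrite dimvS // subv_add capvSr andbT (subv_trans UX) ?diffvSl.
    have cap_le : (\dim (U :&: (W :&: X)) <= \dim (U :&: W))%N.
      by rewrite dimvS // capvS ?subvv ?capvSl.
    apply: leq_trans cap_le; rewrite -(ltn_add2l (\dim (U + W :&: X))) addn0.
    rewrite dimv_sum_cap (leq_ltn_trans sum_le) // dimU addSn ltnS.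
    by rewrite -[leqLHS](subnK le_tX) leq_add2l intM.
  rewrite leq_subLR.
  apply: (@leq_trans #|(U :&: W)%VS|); first by rewrite card_vspace -{1}(expn1 q) leq_exp2l.
  rewrite (cardD1 0) leq_add ?leq_b1 //; apply: subset_leq_card.
  by apply/subsetP=> v; rewrite !inE memv_cap => /and3P[-> -> ->].
- move=> v; rewrite inE => /andP[vU v0]; apply: IHr.
    rewrite dim_add_line; first by rewrite subnS Dr.
    by apply: contra v0 => vY; rewrite (UY0 v vU vY).
  by rewrite (leq_trans le_tY) // dimvS // addvSl.
- rewrite exprS mulrA ler_wpM2r ?exprn_ge0 //.
  apply: (@le_trans _ _ (q%:R ^+ (j - t).+1)).
    rewrite -natrX ler_nat; apply: (@leq_trans #|U|).
      by apply: subset_leq_card; apply/subsetP => v; rewrite !inE => /andP[].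
    by rewrite card_vspace dimU leq_exp2l // ltnS leq_sub2r ?dimM.
  rewrite exprS mulrA ler_wpM2r ?exprn_ge0 ?(ltW q_gt0) //.
  have q1 : q%:R - 1 != 0 :> rat by rewrite subr_eq0 gt_eqF // ltr1n.
  have q0 : q%:R != 0 :> rat by rewrite gt_eqF.
  rewrite (_ : (q - 1)%N%:R * x = q%:R) // natrB ?(ltnW q_gt1) //.
  by field; rewrite q1 q0.
Qed.

(** The first t dimensions are chosen at once, as a subspace of one fixed member:
    this costs the Gaussian constant instead of a factor x^t. *)
Lemma card_level t j M :
    t_intersecting t M -> (forall X, X \in M -> (\dim X <= j)%N) ->
    shrinking_breaks t M ->
  #|level M j|%:R <= G * x ^+ (j - t) * q%:R ^+ (j * (j - t)).
Proof.
move=> intM dimM proofM; have q_ge0 := ltW q_gt0.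
have [->|[X]] := set_0Vmem (level M j).
  by rewrite cards0 !mulr_ge0 ?exprn_ge0.
rewrite inE => /andP[XM /eqP dimX].
have le_tj : (t <= j)%N by rewrite -dimX -(capvv X) intM.
have cover : level M j \subset
    \bigcup_(Z in subspaces_within X t) members_above (level M j) Z.
  apply/subsetP => W WL; have := WL; rewrite inE => /andP[WM _].
  have [Z ZXW dimZ] := subspace_of_dim (intM X W XM WM).
  apply/bigcupP; exists Z; last by rewrite inE WL (subv_trans ZXW) ?capvSr.
  by rewrite !inE dimZ eqxx (subv_trans ZXW) ?capvSl.
apply: (@le_trans _ _ (\sum_(Z in subspaces_within X t)
    #|members_above (level M j) Z|%:R)).
  rewrite -natr_sum ler_nat (leq_trans (subset_leq_card cover)) //.
  exact: card_bigcup_le.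
apply: (@le_trans _ _ (\sum_(Z in subspaces_within X t)
    (x * q%:R ^+ (j - t)) ^+ (j - t))).
  apply: ler_sum => Z; rewrite !inE => /andP[/eqP dimZ _].
  by rewrite -{2}dimZ card_level_above // dimZ.
rewrite sumr_const -[leLHS]mulr_natl.
have -> : #|subspaces_within X t| = #|members_above (subspaces_within X t) 0|.
  by apply: eq_card => Z; rewrite !inE sub0v andbT.
have -> : G * x ^+ (j - t) * q%:R ^+ (j * (j - t)) =
    G * q%:R ^+ ((t - \dim (0%VS : {vspace V})) * (\dim X - t))
    * (x * q%:R ^+ (j - t)) ^+ (j - t).
  rewrite dimv0 subn0 dimX exprMn -exprM.
  have -> : (j * (j - t) = t * (j - t) + (j - t) * (j - t))%N by rewrite -mulnDl subnKC.
  by rewrite exprD; ring.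
rewrite ler_wpM2r ?card_subspaces_between //.
by rewrite exprn_ge0 // mulr_ge0 ?exprn_ge0.
Qed.

(** * Peeling off one dimension after another *)

Variables (k t : nat) (A : {set {vspace V}}).
Hypothesis dimA : A \subset k_subspaces F n k.

(** The bound of [card_level] times the number of k-dimensional subspaces above a
    j-dimensional one. *)
Definition peeling_loss j : rat :=
  G ^+ 2 * x ^+ (j - t) * q%:R ^+ (j * (j - t) + (k - j) * (n - k)).

Lemma peel_one_dimension j T : t_intersecting t T ->
    (forall X, X \in T -> (\dim X <= j.+1)%N) ->
  exists T', [/\ t_intersecting t T', forall X, X \in T' -> (\dim X <= j)%N
    & #|A :\: members_above_family A T'|%:R
        <= #|A :\: members_above_family A T|%:R + peeling_loss j.+1].
Proof.
move=> intT dimT; have q_ge0 := ltW q_gt0.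
have [M [intM dimM covM proofM]] := minimal_refinement intT dimT.
exists (M :\: level M j.+1); split.
- by move=> X Z; rewrite !inE => /andP[_ XM] /andP[_ ZM]; apply: intM.
- move=> X; rewrite !inE => /andP[+ XM]; rewrite XM /= => neq.
  by have := dimM X XM; rewrite leq_eqVlt (negPf neq).
have sub : A :\: members_above_family A (M :\: level M j.+1) \subset
    (A :\: members_above_family A T) :|: \bigcup_(X in level M j.+1) members_above A X.
  apply/subsetP => S; rewrite in_setD => /andP[notT' SA].
  rewrite in_setU in_setD SA andbT -implybE.
  apply/implyP => /bigcupP[X XT]; rewrite inE SA /= => XS.
  have [Z ZM ZX] := covM X XT.
  have Smem : S \in members_above A Z by rewrite inE SA (subv_trans ZX).
  apply/bigcupP; exists Z => //; apply: contraR notT' => ZL.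
  by apply/bigcupP; exists Z; rewrite // in_setD ZL.
apply: (@le_trans _ _ (#|A :\: members_above_family A T|
    + #|\bigcup_(X in level M j.+1) members_above A X|)%N%:R).
  by rewrite ler_nat (leq_trans (subset_leq_card sub)) // leq_card_setU.
rewrite natrD lerD2l.
apply: (@le_trans _ _ (\sum_(X in level M j.+1) #|members_above A X|%:R)).
  by rewrite -natr_sum ler_nat card_bigcup_le.
apply: (@le_trans _ _ (\sum_(X in level M j.+1) G * q%:R ^+ ((k - j.+1) * (n - k)))).
  apply: ler_sum => X; rewrite inE => /andP[_ /eqP <-].
  have := @card_subspaces_between F n fullv X k.
  rewrite dimvf /dim /= mul1n; apply: le_trans; rewrite ler_nat; apply: subset_leq_card.
  apply/subsetP => S; rewrite !inE => /andP[SA ->]; rewrite subvf andbT.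
  by have := subsetP dimA S SA; rewrite inE => ->.
rewrite sumr_const -[leLHS]mulr_natl.
have -> : peeling_loss j.+1 = G * x ^+ (j.+1 - t) * q%:R ^+ (j.+1 * (j.+1 - t))
    * (G * q%:R ^+ ((k - j.+1) * (n - k))).
  by rewrite /peeling_loss exprD; ring.
by rewrite ler_wpM2r ?card_level // mulr_ge0 ?exprn_ge0.
Qed.

Lemma peel r c T : t_intersecting t T ->
    (forall X, X \in T -> (\dim X <= c + r)%N) ->
  exists C, [/\ t_intersecting t C, forall X, X \in C -> (\dim X <= c)%N
    & #|A :\: members_above_family A C|%:R
        <= #|A :\: members_above_family A T|%:R + \sum_(a < r) peeling_loss (c + a).+1].
Proof.
elim: r T => [|r IHr] T intT dimT.
  by exists T; rewrite big_ord0 addr0; split=> // X; rewrite -(addn0 c); apply: dimT.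
have [|T' [intT' dimT' leT']] := @peel_one_dimension (c + r) T intT.
  by move=> X; rewrite -addnS; apply: dimT.
have [C [intC dimC leC]] := IHr T' intT' dimT'.
exists C; split=> //; apply: le_trans leC _.
by rewrite big_ord_recr /= [X in _ <= _ + X]addrC addrA lerD2r.
Qed.

End Peeling.

(** * Summing the losses *)

Section BoundConstant.

Variables (q k t s m : nat).
Hypotheses (q_gt1 : (1 < q)%N) (Dk : k = (s + t + m.+1)%N).
Local Notation y := (q%:R^-1 : rat).
Local Notation x := ((1 - y)^-1).

(** The power x^(s+1) and the two Gaussian constants are common to all dimensions;
    what is left is the cost of the summation over them. *)
Lemma bound_constantE n : bound_constant q n k t s =
  (if n == (2 * k + s + 1)%N then 2 * x ^+ m.+1 else x ^+ 2) * x ^+ s.+1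
    * (1 - y - y ^+ 2)^-1 ^+ 2.
Proof.
have q_ne0 : q%:R != 0 :> rat by rewrite gt_eqF // natr_gt0.
have q1_ne0 : q%:R - 1 != 0 :> rat by rewrite subr_eq0 gt_eqF // ltr1n.
have q_ge2 : 2 <= q%:R :> rat by rewrite ler_nat.
have q2_ne0 : q%:R ^+ 2 - q%:R - 1 != 0 :> rat.
  by rewrite gt_eqF //; move: q_ge2; nra.
have -> : x = q%:R / (q%:R - 1) by field; rewrite q_ne0 q1_ne0.
have -> : (1 - y - y ^+ 2)^-1 = 1 + (q%:R + 1) / (q%:R ^+ 2 - q%:R - 1).
  by field; rewrite q_ne0 q2_ne0.
rewrite /bound_constant; have -> : (k - t + 1 = m.+1 + s.+1)%N by lia.
have -> : (s + 3 = 2 + s.+1)%N by lia.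
by case: ifP => _; rewrite exprD !mulrA.
Qed.

End BoundConstant.

Section Exponents.

Variables (k t s m d : nat).
Hypothesis Dk : k = (s + t + m.+1)%N.

Lemma bound_exponentE : bound_exponent (2 * k + s + 1 + d) k t s =
  ((s + t).+1 * s.+1 + m * (2 * k + s + 1 + d - k))%N%:Z.
Proof. by rewrite /bound_exponent; nia. Qed.

(** The exponent is convex in the dimension, hence largest at an end; at a = m its
    shortfall with respect to a = 0 is m d, and the two ends tie when d = 0. *)
Lemma loss_exponentE a : (a <= m)%N -> let n := (2 * k + s + 1 + d)%N in
  let j := (s + t + a).+1 in
  (j * (j - t) + (k - j) * (n - k) + (a * (m - a) + a * d)
    = (s + t).+1 * s.+1 + m * (n - k))%N.
Proof.
move=> le_am /=; have [b Dm] : exists b, m = (a + b)%N by exists (m - a)%N; lia.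
have -> : ((s + t + a).+1 - t = s.+1 + a)%N by lia.
have -> : (k - (s + t + a).+1 = b)%N by lia.
have -> : (2 * k + s + 1 + d - k = k + s + 1 + d)%N by lia.
have -> : (m - a = b)%N by lia.
rewrite Dk Dm; ring.
Qed.

End Exponents.

Lemma sum_peeling_loss (F : finFieldType) (n k t s m d : nat) :
    k = (s + t + m.+1)%N -> n = (2 * k + s + 1 + d)%N ->
  \sum_(a < m.+1) peeling_loss F n k t (s + t + a).+1
    <= bound_constant #|F| n k t s * #|F|%:R ^ bound_exponent n k t s.
Proof.
move=> Dk Dn; have q_gt1 : (1 < #|F|)%N := finNzRing_gt1 F.
have q_gt0 := natr_gt0 q_gt1.
set q := #|F| in q_gt1 q_gt0 *; pose y : rat := q%:R^-1.
have y_gt0 : 0 < y := natr_inv_gt0 q_gt1.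
have y_le_half : 2 * y <= 1 := natr_inv_le_half q_gt1.
have y_lt1 : y < 1 := natr_inv_lt1 q_gt1.
rewrite (bound_constantE q_gt1 Dk) Dn (bound_exponentE d Dk) -exprnP -Dn.
set e0 := (_ + m * (n - k))%N; set x := (1 - y)^-1; set G := (1 - y - y ^+ 2)^-1.
have x_ge0 : 0 <= x by rewrite invr_ge0 subr_ge0 ltW.
have -> : \sum_(a < m.+1) peeling_loss F n k t (s + t + a).+1 =
    \sum_(a < m.+1) x ^+ a * y ^+ (a * (m - a) + a * d)
      * (x ^+ s.+1 * G ^+ 2 * q%:R ^+ e0).
  apply: eq_bigr => a _; have := loss_exponentE d Dk (_ : a <= m)%N.
  rewrite -ltnS ltn_ord -Dn => /(_ isT) /= De.
  have y_cancel E e : q%:R ^+ e = y ^+ E * q%:R ^+ (e + E) :> rat.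
    by rewrite exprD exprVn mulrC mulfK // expf_neq0 // gt_eqF.
  rewrite /e0 -De /peeling_loss -/q -/y -/x -/G.
  have -> : ((s + t + a).+1 - t = a + s.+1)%N by lia.
  by rewrite (y_cancel (a * (m - a) + a * d)%N) exprD; ring.
rewrite -mulr_suml -!mulrA ler_wpM2r //.
  by rewrite !mulr_ge0 ?exprn_ge0 // ?(ltW q_gt0) // invr_ge0 ltW ?euler_const_gt0.
case: ifPn => [/eqP|] neq.
  have -> : d = 0 by lia.
  under eq_bigr do rewrite muln0 addn0.
  exact: tight_sum_le.
by apply: slack_sum_le => //; lia.
Qed.

Theorem theorem1p9 (q : nat) (F : finFieldType) (hq : #|F| = q)
    (n k t s : nat) (hn0 : (0 < n)%N) (hk0 : (0 < k)%N) (ht0 : (0 < t)%N)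
    (hk : (s + t + 1 <= k)%N) (hn : (2 * k + s + 1 <= n)%N)
    (A : {set {vspace 'rV[F]_n}}) (hA : A \subset k_subspaces F n k)
    (hint : t_intersecting t A) :
  exists C : {set {vspace 'rV[F]_n}},
    [/\ t_intersecting t C,
        (forall S : {vspace 'rV[F]_n}, S \in C -> (\dim S <= s + t)%N)
      & #|A :\: members_above_family A C|%:R
          <= bound_constant q n k t s * q%:R ^ bound_exponent n k t s].
Proof.
rewrite -hq.
have Dk : k = (s + t + (k - (s + t)).-1.+1)%N by lia.
have Dn : n = (2 * k + s + 1 + (n - (2 * k + s + 1)))%N by lia.
have [X XA|C [intC dimC leC]] := peel (r := (k - (s + t)).-1.+1) (c := s + t) hA hint.
  by have := subsetP hA X XA; rewrite inE -Dk => /eqP->.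
exists C; split=> //; apply: le_trans (sum_peeling_loss F Dk Dn).
apply: le_trans leC _; rewrite gerDr.
suff -> : A :\: members_above_family A A = set0 by rewrite cards0.
apply/eqP; rewrite setD_eq0; apply/subsetP => S SA.
by apply/bigcupP; exists S; rewrite // inE SA subvv.
Qed.
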